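(* Suppose the $6$ vertices of the complete $3$-uniform hypergraph $K^3_6$ are placed at points of $\mathbb{R}^3$ that are in convex position and in general position. Then the number of crossing pairs of hyperedges of $K^3_6$ is exactly $3$.
   Context: The hyperedges of $K^3_6$ are all $3$-element subsets of its $6$-element vertex set; each hyperedge is drawn as the $2$-simplex (triangle) that is the convex hull of its three vertices. Points in $\mathbb{R}^3$ are in general position if no $4$ of them lie on a common plane, and in convex position if each of them is a vertex of the convex hull of all of them. Two hyperedges form a crossing pair if they are vertex-disjoint and the corresponding simplices have a common point in their relative interiors. Pairs of hyperedges are unordered. *)

(* Defs.v *)
From mathcomp Require Import all_boot all_order all_algebra.
From mathcomp Require Import all_classical all_reals all_analysis.

Set Implicit Arguments.
Unset Strict Implicit.
Unset Printing Implicit Defensive.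

Import Order.TTheory GRing.Theory Num.Theory.
Import numFieldNormedType.Exports.

Local Open Scope classical_set_scope.
Local Open Scope ring_scope.

Section ConvexGeometry.
Context {R : realType}.

Definition convex_hull {E : lmodType R} (A : set E) : set E :=
  smallest (@convex_set R E) A.

Definition affine_set {E : lmodType R} (A : set E) : Prop :=
  forall (x y : E) (t : R), A x -> A y -> A (t *: x + (1 - t) *: y).

Definition affine_hull {E : lmodType R} (A : set E) : set E :=
  smallest affine_set A.

(* Interior of A for the topology induced on its affine hull. *)
Definition relative_interior {E : normedModType R} (A : set E) : set E :=
  [set x | A x /\ within (affine_hull A) (nbhs x) A].

Definition hyperplane {d : nat} (u : 'cV[R]_d) (c : R) : set 'rV[R]_d :=
  [set x | (x *m u) 0 0 = c].

(* A vertex of a polytope P is a 0-dimensional face: {v} is cut out of P by a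
   hyperplane that has P on one (closed) side. *)
Definition polytope_vertex {d : nat} (P : set 'rV[R]_d) (v : 'rV[R]_d) : Prop :=
  exists (u : 'cV[R]_d) (c : R),
    (forall x, P x -> (x *m u) 0 0 <= c) /\ P `&` hyperplane u c = [set v].

End ConvexGeometry.

Definition complete_hyperedges (k n : nat) : {set {set 'I_n}} :=
  [set e : {set 'I_n} | #|e| == k]%SET.

Section Drawing.
Context {R : realType} {n : nat}.
Variable p : 'I_n -> 'rV[R]_3.

(* Quantifying over sets of four indices rather than of four points also
   excludes coinciding points when 4 <= n: two equal points and any two others
   lie on a common plane. *)
Definition general_position : Prop :=
  forall S : {set 'I_n}, #|S| = 4%N ->
    ~ exists (u : 'cV[R]_3) (c : R), u != 0 /\ p @` [set` S] `<=` hyperplane u c.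

Definition convex_position : Prop :=
  forall i : 'I_n, polytope_vertex (convex_hull (range p)) (p i).

Definition drawn_simplex (e : {set 'I_n}) : set 'rV[R]_3 :=
  convex_hull (p @` [set` e]).

Definition crossing (e f : {set 'I_n}) : Prop :=
  [disjoint e & f]%B /\
  relative_interior (drawn_simplex e) `&` relative_interior (drawn_simplex f)
    !=set0.

(* An unordered pair of hyperedges is the two-element set of them. *)
Definition crossing_pairs (k : nat) : {set {set {set 'I_n}}} :=
  [set P : {set {set 'I_n}} |
    `[< exists e f : {set 'I_n},
          [/\ e \in complete_hyperedges k n, f \in complete_hyperedges k n,
              P = [set e; f]%SET & crossing e f] >]]%SET.

End Drawing.

(* Main.v *)
Require Import Defs.
From mathcomp Require Import all_boot all_order all_algebra.
From mathcomp Require Import all_classical all_reals all_analysis.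

(** Why there are exactly three crossing pairs.

    Two complementary triples of the six points cross when some point is a
    positive convex combination of each triple. Subtracting the two expressions,
    this says that the points have an affine dependency (coefficients c_i with
    sum c_i = 0 and sum c_i p_i = 0) that is positive on one triple and negative
    on the other ([crossing_setCP]). So the problem is to count the sign
    patterns of type 3+3 of affine dependencies.

    Two facts control these signs. General position makes any four points an
    affine basis ([barycentric_coordinates]); hence a nonzero dependency has at
    most one zero coefficient, and the dependencies form a plane. Convex
    position forces a nonzero dependency to have at least two positive and, by
    symmetry, at least two negative coefficients
    ([affine_dependency_pos2]): a single positive coefficient would express a
    vertex of the hull through the other points.

    Fix a vertex l. Scaled to have value 1 at l, the dependencies form an affine
    line b + t a, where a vanishes at l. Each of the five coordinates other than
    l is an affine function of t with its own root, and the five roots are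
    distinct because no dependency has two zeros. As t runs over the line, the
    number of positive coefficients changes by one at each root, and away from
    the roots it lies between 2 and 4. It therefore equals 3 exactly when it is
    odd, which happens on every other one of the six intervals cut out by the
    roots: on three of them. Different intervals give different sign patterns,
    since a root separates them, and all patterns of type 3+3 arise this way
    after a choice of sign. This is the planar Gale diagram of the six points,
    swept by a rotating line.

    The alternation is organised without sorting the roots: the set of positive
    coefficients is a fixed set modified on the set of roots below t
    ([mem_positive_support_pencil]), and the sets of roots below some t form a
    chain with one member of each size ([sublevel_eq_card],
    [sublevel_card_exists]). *)

Set Implicit Arguments.
Unset Strict Implicit.
Unset Printing Implicit Defensive.

Import Order.TTheory GRing.Theory Num.Theory.
Import numFieldNormedType.Exports.

Local Open Scope classical_set_scope.
Local Open Scope ring_scope.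

(** * Simplices and their relative interiors *)

Section Simplices.
Context {R : realType}.

Lemma convex_setP (E : lmodType R) (A : set E) :
  @convex_set R E A <->
  forall x y (t : R), 0 <= t -> t <= 1 -> A x -> A y -> A (t *: x + (1 - t) *: y).
Proof.
split=> [cA x y t t0 t1 Ax Ay|cA x y t].
  have := cA x y (Itv01 t0 t1); rewrite !inE => /(_ Ax Ay).
  by rewrite /conv.
rewrite !inE => Ax Ay; exact: (cA x y t%:num).
Qed.

Lemma convex_set_sum (E : lmodType R) (I : finType) (C : set E)
    (e : {set I}) (p : I -> E) (w : I -> R) :
  @convex_set R E C -> (forall i, i \in e -> C (p i)) ->
  (forall i, i \in e -> 0 <= w i) -> \sum_(i in e) w i = 1 ->
  C (\sum_(i in e) w i *: p i).
Proof.
move=> /convex_setP cC Cp w0 w1.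
(* Induction needs partial sums, which are convex combinations only once
   divided by their total weight. *)
suff rescaled (s : seq I) : {subset s <= e} -> 0 < \sum_(i <- s) w i ->
    C ((\sum_(i <- s) w i)^-1 *: \sum_(i <- s) w i *: p i).
  have := rescaled (enum e); rewrite !big_enum /= w1 invr1 scale1r; apply=> //.
  by move=> i; rewrite mem_enum.
elim: s => [|i s IHs] sub; first by rewrite big_nil ltxx.
rewrite !big_cons.
have ie : i \in e by apply: sub; rewrite mem_head.
have {}sub : {subset s <= e} by move=> j js; apply: sub; rewrite in_cons js orbT.
have := w0 i ie; rewrite le_eqVlt => /predU1P[<-|wi] W.
  by rewrite add0r scale0r add0r in W *; exact: IHs.
have s0 : 0 <= \sum_(j <- s) w j.
  by rewrite big_seq; apply: sumr_ge0 => j /sub; exact: w0.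
move: s0; rewrite le_eqVlt => /predU1P[s0|s0].
  suff -> : \sum_(j <- s) w j *: p j = 0.
    by rewrite -s0 !addr0 scalerA mulVf ?gt_eqF// scale1r; exact: Cp.
  move/esym/eqP: s0; rewrite big_seq psumr_eq0 => [/allP z|j /sub]; last exact: w0.
  rewrite big_seq big1// => j js.
  by have := z j js; rewrite js /= => /eqP ->; rewrite scale0r.
have := cC (p i) _ (w i / (w i + \sum_(j <- s) w j)) _ _ (Cp _ ie) (IHs sub s0).
set S := \sum_(j <- s) w j in W s0 *.
have -> : 1 - w i / (w i + S) = S / (w i + S).
  by rewrite -[X in X - _](@divff _ (w i + S)) ?gt_eqF// -mulrBl [w i + S]addrC addrK.
rewrite scalerA mulrAC divff ?gt_eqF// mul1r.
rewrite [w i / _]mulrC -scalerA -scalerDr; apply.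
- by rewrite mulrC; apply: divr_ge0; exact: ltW.
- by rewrite mulrC ler_pdivrMr// mul1r lerDl ltW.
Qed.

Lemma simplexP (n : nat) (p : 'I_n -> 'rV[R]_3) (e : {set 'I_n}) x :
  drawn_simplex p e x <->
  exists w : 'I_n -> R, [/\ forall i, i \in e -> 0 <= w i,
    \sum_(i in e) w i = 1 & x = \sum_(i in e) w i *: p i].
Proof.
split; last first.
  move=> [w [w0 w1 ->]] C [cC pC].
  by apply: convex_set_sum => // i ie; apply: pC; exists i.
move: x; apply: smallest_sub.
  apply/convex_setP => _ _ t t0 t1 [v [v0 v1 ->]] [w [w0 w1 ->]].
  exists (fun i => t * v i + (1 - t) * w i); split.
  - by move=> i ie; rewrite addr_ge0// mulr_ge0 ?v0 ?w0 ?subr_ge0.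
  - by rewrite big_split/= -!mulr_sumr v1 w1 !mulr1 subrKC.
  - rewrite !scaler_sumr -big_split/=; apply: eq_bigr => i _.
    by rewrite !scalerA -scalerDl.
move=> _ [i /= ie <-]; exists (fun j => (j == i)%:R); split.
- by move=> j _; exact: ler0n.
- by rewrite (bigD1 i)//= eqxx big1 ?addr0// => j /andP[_ /negbTE ->].
- rewrite (bigD1 i)//= eqxx scale1r big1 ?addr0// => j /andP[_ /negbTE ->].
  by rewrite scale0r.
Qed.

Lemma affine_hull_simplex (n : nat) (p : 'I_n -> 'rV[R]_3) (e : {set 'I_n}) x :
  affine_hull (drawn_simplex p e) x ->
  exists2 w : 'I_n -> R,
    \sum_(i in e) w i = 1 & x = \sum_(i in e) w i *: p i.
Proof.
move: x; apply: smallest_sub => [|y /simplexP[w [_ w1 ->]]]; last by exists w.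
move=> _ _ t [v v1 ->] [w w1 ->]; exists (fun i => t * v i + (1 - t) * w i).
  by rewrite big_split/= -!mulr_sumr v1 w1 !mulr1 subrKC.
rewrite !scaler_sumr -big_split/=; apply: eq_bigr => i _.
by rewrite !scalerA -scalerDl.
Qed.

(** A point x of the relative interior can be pushed slightly further away from
    the centroid g of the simplex to a point y of the simplex. Then x lies on
    the segment from g to y, and every weight of g is positive. *)
Lemma relative_interior_simplex_pos (n : nat) (p : 'I_n -> 'rV[R]_3)
    (e : {set 'I_n}) x :
  relative_interior (drawn_simplex p e) x ->
  exists w : 'I_n -> R, [/\ forall i, i \in e -> 0 < w i,
    \sum_(i in e) w i = 1 & x = \sum_(i in e) w i *: p i].
Proof.
move=> [Ax nx].
have e0 : (0 < #|e|)%N.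
  have /simplexP[w [_ w1 _]] := Ax; rewrite card_gt0; apply/eqP => e0.
  by move: w1; rewrite e0 big_set0 => /esym/eqP; rewrite oner_eq0.
pose m : R := (#|e|%:R)^-1; have m0 : 0 < m by rewrite invr_gt0 ltr0n.
pose g := \sum_(i in e) m *: p i.
have sm : \sum_(i in e) m = 1.
  by rewrite sumr_const /m -[LHS]mulr_natl divff// pnatr_eq0 -lt0n.
have Ag : drawn_simplex p e g.
  by apply/simplexP; exists (fun=> m); split=> // i _; exact: ltW.
have [t [t0 Ay]] : exists t : R, 0 < t /\ drawn_simplex p e (x + t *: (x - g)).
  have c : (fun t : R => x + t *: (x - g)) @ (0 : R)^'+ --> x.
    apply: cvg_at_right_filter.
    rewrite -[X in _ --> X]addr0 -[X in _ --> _ + X](scale0r (x - g)).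
    by apply: cvgD; [exact: cvg_cst|apply: cvgZr_tmp; exact: cvg_id].
  have near : \forall t \near (0 : R)^'+, drawn_simplex p e (x + t *: (x - g)).
    have : \forall t \near (0 : R)^'+, affine_hull (drawn_simplex p e)
        (x + t *: (x - g)) -> drawn_simplex p e (x + t *: (x - g)) := c _ nx.
    apply: filterS => t; apply=> B [aB AB].
    have -> : x + t *: (x - g) = (1 + t) *: x + (1 - (1 + t)) *: g.
      by rewrite opprD addrA subrr add0r scalerDl scale1r scaleNr scalerBr addrA.
    by apply: aB; apply: AB.
  have [t [t0 At]] := @filter_ex _ _ _ _ (filterI (nbhs_right_gt 0) near).
  by exists t.
have /simplexP[w [w0 w1 yE]] := Ay.
have t1 : 0 < 1 + t by rewrite addr_gt0.
exists (fun i => (1 + t)^-1 * (w i + t * m)); split.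
- by move=> i ie; rewrite mulr_gt0 ?invr_gt0// ltr_wpDl ?w0 ?mulr_gt0.
- by rewrite -mulr_sumr big_split/= -mulr_sumr w1 sm mulr1 mulVf ?gt_eqF.
- under eq_bigr do rewrite -scalerA scalerDl -scalerA.
  rewrite -scaler_sumr big_split/= -scaler_sumr -yE -/g.
  rewrite -addrA -scalerDr subrK -[X in _ *: (X + _)]scale1r -scalerDl scalerA.
  by rewrite mulVf ?gt_eqF// scale1r.
Qed.
End Simplices.

(** * Barycentric coordinates with respect to four points *)

Section AffineDependencies.
Context {R : realType} {n : nat}.
Variable p : 'I_n -> 'rV[R]_3.

Lemma continuous_affine_form (V : 'cV[R]_(3 + 1)) :
  continuous (fun y : 'rV[R]_3 => (row_mx y 1%:M *m V) 0 0).
Proof.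
rewrite -[V]vsubmxK.
under eq_fun do rewrite mul_row_col mul1mx mxE [X in X + _]mxE.
move=> y; apply: (@cvgD _ _ _ (nbhs y)); last exact: cvg_cst.
apply: (@cvg_big R); first exact: add_continuous.
by move=> j _; apply: cvgMr_tmp; exact: coord_continuous.
Qed.

(** Four points that span no plane form an affine basis: in homogeneous
    coordinates (append a last coordinate 1), planes are the nonzero column
    vectors, so the 4 x 4 matrix of the points is invertible. *)
Lemma barycentric_coordinates (S : {set 'I_n}) :
  general_position p -> #|S| = 4%N ->
  exists beta : 'I_n -> 'rV[R]_3 -> R,
    [/\ forall i, continuous (beta i),
        forall y, \sum_(i in S) beta i y = 1,
        forall y, \sum_(i in S) beta i y *: p i = y &
        forall w : 'I_n -> R, \sum_(i in S) w i = 1 ->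
          forall i, i \in S -> beta i (\sum_(j in S) w j *: p j) = w i].
Proof.
move=> gp S4.
pose f (k : 'I_(3 + 1)) : 'I_n := enum_val (cast_ord (esym S4) k).
have finj : injective f by move=> j k /enum_val_inj /cast_ord_inj.
have fS : [set f k | k in 'I_(3 + 1)]%SET = S.
  apply/setP => i; apply/imsetP/idP => [[k _ ->]|iS]; first exact: enum_valP.
  exists (cast_ord S4 (enum_rank_in iS i)) => //.
  by rewrite /f cast_ordK enum_rankK_in.
have sumS (V : nmodType) (F : 'I_n -> V) :
    \sum_(i in S) F i = \sum_k F (f k).
  by rewrite -fS big_imset => [|j k _ _ /finj].
pose P := \matrix_k p (f k); pose M := row_mx P (const_mx 1 : 'cV_(3 + 1)).
have homE (w : 'rV_(3 + 1)) :
    w *m M = row_mx (\sum_k w 0 k *: p (f k)) (\sum_k w 0 k)%:M.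
  rewrite mul_mx_row mulmx_sum_row; congr row_mx.
    by apply: eq_bigr => k _; rewrite rowK.
  apply/matrixP => i j; rewrite !ord1 !mxE eqxx mulr1n.
  by apply: eq_bigr => k _; rewrite mxE mulr1.
have uM : M \in unitmx.
  rewrite unitmxE unitfE -det_tr; apply/negP => /det0P[v v0 vM].
  have vk k : (p (f k) *m (lsubmx v)^T) 0 0 + v 0 (rshift 3 0) = 0.
    move/matrixP/(_ 0 k): vM; rewrite tr_row_mx -[X in X *m _]hsubmxK mul_row_col.
    rewrite mxE [X in X + _]mxE [X in _ + X]mxE big_ord1 [X in _ = X]mxE => <-.
    rewrite !mxE mulr1; congr (_ + _).
    by apply: eq_bigr => j _; rewrite !mxE mulrC.
  apply: (gp S S4); exists (lsubmx v)^T, (- v 0 (rshift 3 0)); split.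
    apply: contra_neq v0 => u0; have := vk 0; rewrite u0 mulmx0 mxE add0r => c0.
    rewrite -[v]hsubmxK -[lsubmx v]trmxK u0 trmx0.
    suff -> : rsubmx v = 0 by rewrite row_mx0.
    by apply/matrixP => i j; rewrite !ord1 !mxE.
  move=> _ [i /= iS <-]; move: iS; rewrite -fS => /imsetP[k _ ->].
  by rewrite /hyperplane /=; apply/eqP; rewrite -addr_eq0 vk.
pose beta i y := (row_mx y 1%:M *m
  (invmx M *m \col_k (f k == i)%:R)) 0 0.
have betaf k y : beta (f k) y = (row_mx y 1%:M *m invmx M) 0 k.
  rewrite /beta mulmxA mxE (bigD1 k)//= mxE eqxx mulr1 big1 ?addr0// => j jk.
  by rewrite mxE (inj_eq finj) (negbTE jk) mulr0.
have betaE y := eq_row_mx (etrans (esym (mulmxKV uM (row_mx y 1%:M)))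
  (homE (row_mx y 1%:M *m invmx M))).
exists beta; split=> [i|y|y|w w1 i].
- exact: continuous_affine_form.
- have [_ /matrixP/(_ 0 0)] := betaE y; rewrite mxE eqxx mulr1n mxE mulr1n => ->.
  by rewrite sumS; apply: eq_bigr => k _; rewrite betaf.
- have [+ _] := betaE y => {2}->.
  by rewrite sumS; apply: eq_bigr => k _; rewrite betaf.
- rewrite -{1}fS => /imsetP[k _ ->]; rewrite betaf.
  pose v := \row_k w (f k).
  have -> : \sum_(j in S) w j *: p j = \sum_k v 0 k *: p (f k).
    by rewrite sumS; apply: eq_bigr => j _; rewrite mxE.
  have -> : 1 = \sum_k v 0 k.
    by rewrite -w1 sumS; apply: eq_bigr => j _; rewrite mxE.
  by rewrite -homE mulmxK// mxE.
Qed.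
End AffineDependencies.

(** * Affine dependencies *)

Definition affine_dependency {R : realType} {n : nat} (p : 'I_n -> 'rV[R]_3)
    (c : 'I_n -> R) : Prop :=
  \sum_i c i = 0 /\ \sum_i c i *: p i = 0.

Definition positive_support {R : realType} {T : finType} (c : T -> R) :
  {set T} := [set i | 0 < c i]%SET.

Section Dependencies.
Context {R : realType} {n : nat}.
Variable p : 'I_n -> 'rV[R]_3.

Lemma sum_delta k : \sum_(l < n) (l == k)%:R = 1 :> R.
Proof. by rewrite (bigD1 k)//= eqxx big1 ?addr0// => l /negbTE ->. Qed.

Lemma sum_delta_scale (V : lmodType R) (k : 'I_n) (F : 'I_n -> V) :
  \sum_l ((l == k)%:R : R) *: F l = F k.
Proof.
rewrite (bigD1 k)//= eqxx scale1r big1 ?addr0// => l /negbTE ->.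
by rewrite scale0r.
Qed.

Lemma affine_dependency_lin (c d : 'I_n -> R) s t :
  affine_dependency p c -> affine_dependency p d ->
  affine_dependency p (fun i => s * c i + t * d i).
Proof.
move=> [c0 cp] [d0 dp]; split.
  by rewrite big_split/= -!mulr_sumr c0 d0 !mulr0 addr0.
under eq_bigr do rewrite scalerDl -!scalerA.
by rewrite big_split/= -!scaler_sumr cp dp !scaler0 addr0.
Qed.

Lemma affine_dependency_diff i j :
  p i = p j ->
  affine_dependency p (fun k => (k == i)%:R - (k == j)%:R).
Proof.
move=> pij; split; first by rewrite sumrB !sum_delta subrr.
under eq_bigr do rewrite scalerBl.
by rewrite sumrB !sum_delta_scale pij subrr.
Qed.

(** Adding such a dependency to the barycentric coordinates of a point gives
    barycentric coordinates of the same point; they are unique. *)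
Lemma affine_dependency_support4 (S : {set 'I_n}) (c : 'I_n -> R) :
  general_position p -> #|S| = 4%N -> affine_dependency p c ->
  (forall i, i \notin S -> c i = 0) -> forall i, c i = 0.
Proof.
move=> gp S4 [c0 cp] cS i.
have [iS|/cS//] := boolP (i \in S).
have [beta [_ b1 bp bw]] := barycentric_coordinates gp S4.
have c0S : \sum_(j in S) c j = 0.
  by rewrite big_mkcond -[RHS]c0; apply: eq_bigr => j _; case: ifPn => // /cS.
have cpS : \sum_(j in S) c j *: p j = 0.
  rewrite big_mkcond -[RHS]cp; apply: eq_bigr => j _; case: ifPn => // /cS ->.
  by rewrite scale0r.
have := bw (fun j => c j + beta j 0); rewrite big_split/= c0S b1 add0r.
move=> /(_ erefl i iS).
under eq_bigr do rewrite scalerDl.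
rewrite big_split/= cpS bp addr0 => /eqP.
by rewrite -subr_eq0 opprD addrCA subrr addr0 oppr_eq0 => /eqP.
Qed.

(** The vertices of the simplex are completed to an affine basis S, so that the
    barycentric coordinates are continuous on the whole space. Near a point
    where those of e are positive they stay positive, and on the affine hull of
    the simplex they are the weights of the vertices. *)
Lemma relative_interior_simplex (e S : {set 'I_n}) (w : 'I_n -> R) :
  general_position p -> #|S| = 4%N -> e \subset S ->
  (forall i, i \in e -> 0 < w i) -> \sum_(i in e) w i = 1 ->
  relative_interior (drawn_simplex p e) (\sum_(i in e) w i *: p i).
Proof.
move=> gp S4 eS w0 w1; set x : 'rV[R]_3 := \sum_(i in e) _.
have [beta [bc _ _ bw]] := barycentric_coordinates gp S4.
have sumS (V : nmodType) (F : 'I_n -> V) :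
    \sum_(i in S) (if i \in e then F i else 0) = \sum_(i in e) F i.
  rewrite -big_mkcondr; apply: eq_bigl => i.
  by rewrite andbC; apply: andb_idr => /(fintype.subsetP eS).
have be (v : 'I_n -> R) i : \sum_(i in e) v i = 1 -> i \in e ->
    beta i (\sum_(i in e) v i *: p i) = v i.
  move=> v1 ie; have := bw (fun j => if j \in e then v j else 0).
  rewrite sumS v1 => /(_ erefl i (fintype.subsetP eS _ ie)); rewrite ie => <-.
  rewrite -sumS; congr beta; apply: eq_bigr => j _.
  by case: ifP => // _; rewrite scale0r.
split.
  by apply/simplexP; exists w; split=> // i /w0/ltW.
have near_pos i : \forall y \near nbhs x, i \in e -> 0 < beta i y.
  have [ie|ie] := boolP (i \in e); last by apply: nearW.
  have : \forall y \near nbhs x, 0 < beta i y.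
    by apply: (cvgr_gt _ (bc i x)); rewrite be// w0.
  by apply: filterS.
suff : \forall y \near nbhs x,
  affine_hull (drawn_simplex p e) y -> drawn_simplex p e y by [].
have := filter_forall (nbhs_filter x) near_pos.
apply: filterS => y b0 /affine_hull_simplex[v v1 yE].
apply/simplexP; exists v; split=> // i ie.
by rewrite ltW// -(be v i v1 ie) -yE b0.
Qed.
End Dependencies.

Section SixPoints.
Context {R : realType}.
Variable p : 'I_6 -> 'rV[R]_3.
Hypothesis gp : general_position p.

Lemma card_setC2 (i j : 'I_6) : i != j -> #|~: [set i; j]%SET| = 4%N.
Proof. by move=> ij; rewrite cardsCs finset.setCK cards2 ij card_ord. Qed.

Lemma affine_dependency_two_zeros (c : 'I_6 -> R) i j :
  affine_dependency p c -> i != j -> c i = 0 -> c j = 0 -> forall k, c k = 0.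
Proof.
move=> dc ij ci cj; apply: (affine_dependency_support4 gp (card_setC2 ij) dc).
by move=> k; rewrite finset.in_setC negbK !finset.inE => /orP[] /eqP ->.
Qed.

(** The coefficients come from the expression of p_m as an affine combination of
    the four points other than p_l and p_m. *)
Lemma affine_dependency_exists l m : l != m ->
  exists c : 'I_6 -> R, [/\ affine_dependency p c, c l = 0 & c m = 1].
Proof.
move=> lm; have [beta [_ b1 bp _]] := barycentric_coordinates gp (card_setC2 lm).
set S := (~: _)%SET in b1 bp.
have lS : l \notin S by rewrite !finset.inE eqxx.
have mS : m \notin S by rewrite !finset.inE eqxx orbT.
exists (fun i => (i == m)%:R - (if i \in S then beta i (p m) else 0)); split.
- split; first by rewrite sumrB sum_delta -big_mkcond b1 subrr.
  under eq_bigr do rewrite scalerBl.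
  rewrite sumrB sum_delta_scale -[X in X - _](bp (p m)) big_mkcond -sumrB big1//.
  by move=> i _; case: ifP => _; rewrite ?scale0r subrr.
- by rewrite (negbTE lS) (negbTE lm) subrr.
- by rewrite (negbTE mS) eqxx subr0.
Qed.

Lemma general_position_inj : injective p.
Proof.
move=> i j pij; apply/eqP/negPn/negP => ij.
have /card_gt1P[k [l [+ + kl]]] : (1 < #|~: [set i; j]%SET|)%N.
  by rewrite card_setC2.
rewrite !finset.inE !negb_or => /andP[ki kj] /andP[li lj].
have := affine_dependency_two_zeros (affine_dependency_diff pij) kl.
rewrite (negbTE ki) (negbTE kj) (negbTE li) (negbTE lj) subrr.
move=> /(_ erefl erefl i); rewrite eqxx (negbTE ij) subr0 => /eqP.
by rewrite oner_eq0.
Qed.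
End SixPoints.

(** * Signs of affine dependencies and crossings *)

Section CrossingSigns.
Context {R : realType}.
Variable p : 'I_6 -> 'rV[R]_3.
Hypothesis gp : general_position p.

(** If only c_i were positive, the supporting plane at p_i would be touched by
    all the points carrying a nonzero coefficient. *)
Lemma affine_dependency_one_pos (c : 'I_6 -> R) i :
  convex_position p -> affine_dependency p c ->
  (forall j, j != i -> c j <= 0) -> forall k, c k = 0.
Proof.
move=> cp dc c_le0.
have [u [h [hle hface]]] := cp i.
have hull j : convex_hull (range p) (p j) by move=> C [_]; apply; exists j.
have pi_h : (p i *m u) 0 0 = h.
  by have : [set p i] (p i) by []; rewrite -hface => -[].
have slack j : j != i -> (p j *m u) 0 0 - h < 0.
  move=> ji; rewrite subr_lt0 lt_neqAle hle// andbT; apply: contra_neq ji => jh.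
  apply: (general_position_inj gp).
  by have : [set p i] (p j) by rewrite -hface; split.
have sum0 : \sum_j c j * ((p j *m u) 0 0 - h) = 0.
  under eq_bigr do rewrite mulrBr.
  rewrite sumrB -mulr_suml dc.1 mul0r subr0.
  transitivity (((\sum_j c j *: p j) *m u) 0 0); last by rewrite dc.2 mul0mx mxE.
  rewrite mulmx_suml summxE; apply: eq_bigr => j _.
  by rewrite -scalemxAl [RHS]mxE.
have term_ge0 j : 0 <= c j * ((p j *m u) 0 0 - h).
  have [->|ji] := eqVneq j i; first by rewrite pi_h subrr mulr0.
  by rewrite mulr_le0 ?c_le0// ltW// slack.
have off j : j != i -> c j = 0.
  move=> ji; move/eqP: sum0; rewrite psumr_eq0// => /allP/(_ j).
  rewrite mem_index_enum => /(_ isT) /=; rewrite mulf_eq0 => /orP[/eqP//|].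
  by rewrite lt_eqF// slack.
have /card_gt1P[k [l [+ + kl]]] : (1 < #|~: [set i]%SET|)%N.
  by rewrite cardsC1 card_ord.
rewrite !finset.inE => ki li.
by apply: (affine_dependency_two_zeros gp dc kl); exact: off.
Qed.

Lemma affine_dependency_pos2 (c : 'I_6 -> R) k :
  convex_position p -> affine_dependency p c -> c k != 0 ->
  (2 <= #|positive_support c|)%N.
Proof.
move=> cp dc ck; rewrite leqNgt ltnS; apply: contra_neqN ck => /card_le1P le1.
have [[i ci]|none] := pselect (exists i, 0 < c i).
  apply: (affine_dependency_one_pos cp dc (i := i)) => j.
  have := le1 i; rewrite finset.inE => /(_ ci j).
  by rewrite !finset.inE => <-; rewrite -leNgt.
apply: (affine_dependency_one_pos cp dc (i := k)) => j _.
by rewrite leNgt; apply/negP => cj; apply: none; exists j.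
Qed.

(** A common point of the relative interiors is a positive convex combination
    of each of the two triples; subtracting the two expressions gives the
    affine dependency, and separating signs gives the converse. *)
Lemma crossing_setCP (e : {set 'I_6}) : #|e| = 3%N ->
  crossing p e (~: e) <->
  exists c : 'I_6 -> R, [/\ affine_dependency p c,
    forall i, i \in e -> 0 < c i & forall i, i \notin e -> c i < 0].
Proof.
move=> e3; have e3' : #|~: e| = 3%N by rewrite cardsCs finset.setCK card_ord e3.
split=> [[_ [x [/relative_interior_simplex_pos[v [v0 v1 xv]]
    /relative_interior_simplex_pos[w [w0 w1 xw]]]]]|[c [[c0 cp] ce cn]]].
  exists (fun i => if i \in e then v i else - w i); split.
  - split; rewrite (bigID (mem e))/=.
      rewrite (eq_bigr v) => [|i ->//]; rewrite v1.
      rewrite (eq_bigr (fun i => - w i)) => [|i /negbTE ->//].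
      rewrite sumrN -[RHS](subrr 1) -{3}w1; congr (_ - _).
      by apply: eq_bigl => i; rewrite finset.inE.
    rewrite (eq_bigr (fun i => v i *: p i)) => [|i ->//]; rewrite -xv.
    rewrite (eq_bigr (fun i => - (w i *: p i))) => [|i /negbTE ->]; last first.
      by rewrite scaleNr.
    rewrite sumrN -[RHS](subrr x) {3}xw; congr (_ - _).
    by apply: eq_bigl => i; rewrite finset.inE.
  - by move=> i ie; rewrite ie v0.
  - by move=> i ie; rewrite (negbTE ie) oppr_lt0 w0// finset.inE.
have in4 (f : {set 'I_6}) : #|f| = 3%N ->
    exists2 S : {set 'I_6}, #|S| = 4%N & f \subset S.
  move=> f3; have /set0Pn[j] : (~: f)%SET != finset.set0.
    by rewrite -card_gt0 cardsCs finset.setCK card_ord f3.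
  rewrite finset.inE => jf; exists (j |: f)%SET; last exact: subsetU1.
  by rewrite cardsU1 jf f3.
have [S S4 eS] := in4 _ e3; have [S' S4' eS'] := in4 _ e3'.
pose s := \sum_(i in e) c i.
have [i0 i0e] : exists i, i \in e by apply/set0Pn; rewrite -card_gt0 e3.
have s0 : 0 < s.
  rewrite /s (bigD1 i0)//= ltr_pwDl ?ce//.
  by apply: sumr_ge0 => i /andP[/ce/ltW].
have sN : \sum_(i in (~: e)%SET) c i = - s.
  apply/eqP; rewrite -addr_eq0 addrC; apply/eqP.
  rewrite -[RHS]c0 (bigID (mem e) predT)/=.
  by congr (_ + _); apply: eq_bigl => i; rewrite finset.inE.
have cpN : \sum_(i in (~: e)%SET) c i *: p i = - \sum_(i in e) c i *: p i.
  apply/eqP; rewrite -addr_eq0 addrC; apply/eqP.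
  rewrite -[RHS]cp (bigID (mem e) predT)/=.
  by congr (_ + _); apply: eq_bigl => i; rewrite finset.inE.
split; first by rewrite -setI_eq0 finset.setICr.
exists (\sum_(i in e) (c i / s) *: p i); split.
  apply: (relative_interior_simplex gp S4 eS) => [i ie|].
    by rewrite divr_gt0 ?ce.
  by rewrite -mulr_suml divff// gt_eqF.
have -> : \sum_(i in e) (c i / s) *: p i =
    \sum_(i in (~: e)%SET) (- c i / s) *: p i.
  under eq_bigr do rewrite mulrC -scalerA.
  under [RHS]eq_bigr do rewrite mulNr scaleNr mulrC -scalerA.
  by rewrite sumrN -!scaler_sumr cpN scalerN opprK.
apply: (relative_interior_simplex gp S4' eS') => [i|].
  by rewrite finset.inE => ie; rewrite divr_gt0// oppr_gt0 cn.
by rewrite -mulr_suml sumrN sN opprK divff// gt_eqF.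
Qed.
End CrossingSigns.

(** * Sign changes along a line of coefficient vectors *)

Section Sublevels.
Context {R : realType} {T : finType}.
Variables (D : {set T}) (r : T -> R).

Definition sublevel (t : R) : {set T} := [set i in D | r i < t]%SET.

(** Sublevel sets of one function form a chain. *)
Lemma sublevel_eq_card s t :
  #|sublevel s| = #|sublevel t| -> sublevel s = sublevel t.
Proof.
have mono u v : u <= v -> sublevel u \subset sublevel v.
  move=> uv; apply/fintype.subsetP => i; rewrite !finset.inE => /andP[-> ru].
  exact: lt_le_trans ru uv.
move=> st; apply/eqP.
have [le|/ltW le] := leP s t; first by rewrite eqEcard mono//= st.
by rewrite eq_sym eqEcard mono//= st.
Qed.

(** Raising the threshold just above the next value adds a single element,
    because the values are distinct. *)
Lemma sublevel_card_exists k :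
  {in D &, injective r} -> (k <= #|D|)%N ->
  exists t, (forall i, i \in D -> r i != t) /\ #|sublevel t| = k.
Proof.
move=> rinj; elim: k => [_|k IHk kD].
  exists (- (1 + \sum_i `|r i|)).
  have below i : - (1 + \sum_j `|r j|) < r i.
    rewrite ltrNl (bigD1 i)//=; apply: (@le_lt_trans _ _ `|r i|).
      by rewrite -normrN ler_norm.
    by rewrite addrCA ltrDl ltr_pwDl// sumr_ge0.
  split=> [i _|]; first by rewrite gt_eqF.
  apply/eqP; rewrite cards_eq0; apply/eqP/setP => i.
  by rewrite !finset.inE ltNge ltW ?andbF.
have [t [tD tk]] := IHk (ltnW kD).
have [i0 i0D ti0] : exists2 i, i \in D & t < r i.
  have : (0 < #|D :\: sublevel t|)%N.
    rewrite cardsD subn_gt0.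
    by rewrite (leq_ltn_trans (subset_leq_card (finset.subsetIr _ _)))// tk.
  rewrite card_gt0 => /set0Pn[i]; rewrite !finset.inE andbC => /andP[iD].
  by rewrite iD /= -leNgt le_eqVlt eq_sym (negbTE (tD i iD)) => ti; exists i.
have [m /andP[mD tm] mmin] : exists2 m, (m \in D) && (t < r m) &
    forall j, (j \in D) && (t < r j) -> r m <= r j.
  by case: (@Order.TotalTheory.arg_minP _ _ _ i0 (fun j => (j \in D) && (t < r j)) r)
    => [|m mP mmin]; [rewrite i0D|exists m].
(* The new threshold u exceeds r m, the least value above t, but no larger
   value. *)
have near_above j : \forall u \near (r m)^'+, r m < r j -> u < r j.
  have [mj|jm] := ltP (r m) (r j); last by apply: nearW.
  by apply: filterS (nbhs_right_lt mj) => u uj _.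
have [u [mu uD]] := @filter_ex _ _ _ _ (filterI (nbhs_right_gt (r m))
  (filter_forall (at_right_proper_filter _) near_above)).
have keep j : j \in D -> (r j < u) = (j == m) || (r j < t).
  move=> jD; have [jt|tj] := ltP (r j) t.
    by rewrite orbT (lt_trans jt (lt_trans tm mu)).
  rewrite orbF; have [->//|jm] := eqVneq j m.
  have {}tj : t < r j by rewrite lt_neqAle tj eq_sym tD.
  apply/negbTE; rewrite -leNgt ltW// uD// lt_neqAle mmin ?jD// andbT.
  by apply: contra_neq jm => /rinj ->.
exists u; split=> [j jD|].
  have [jm|jt] := leP (r j) (r m); first by rewrite lt_eqF// (le_lt_trans jm).
  by rewrite gt_eqF ?uD.
have -> : sublevel u = (m |: sublevel t)%SET.
  apply/setP => j; rewrite !finset.inE; have [jD|jD] := boolP (j \in D).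
    by rewrite /= keep.
  by rewrite /= orbF; apply/esym/negbTE; apply: contraNneq jD => ->.
by rewrite cardsU1 tk !finset.inE mD /= ltNge ltW.
Qed.
End Sublevels.

Section Pencils.
Context {R : realType} {T : finType}.
Variables (a b : T -> R) (l : T).
Hypotheses (al : a l = 0) (bl : b l = 1).
Hypothesis a_neq0 : forall i, i != l -> a i != 0.

Definition nowhere_zero (c : T -> R) : Prop := forall i, c i != 0.

Definition pencil (t : R) : T -> R := fun i => b i + t * a i.

Definition pencil_root (i : T) : R := - b i / a i.

(** The support of [pencil t] for t below all the roots. *)
Definition pencil_start : {set T} := [set i | (i == l) || (a i < 0)]%SET.

Local Notation below := (sublevel [set~ l]%SET pencil_root).

Lemma pencil_eq0 t i : i != l -> (pencil t i == 0) = (pencil_root i == t).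
Proof.
move=> il; rewrite /pencil /pencil_root addrC addr_eq0 eq_sym.
by rewrite -[RHS](can_eq (mulfK (a_neq0 il))) mulfVK ?a_neq0.
Qed.

Lemma nowhere_zero_pencilP t :
  nowhere_zero (pencil t) <-> forall i, i \in [set~ l]%SET -> pencil_root i != t.
Proof.
split=> [nz i|nr i]; first by rewrite !finset.inE => il; rewrite -pencil_eq0.
have [->|il] := eqVneq i l; first by rewrite /pencil al bl mulr0 addr0 oner_neq0.
by rewrite pencil_eq0// nr// !finset.inE.
Qed.

(** The coordinate i is affine in t with slope a_i, so its sign changes exactly
    when t passes the root of i. *)
Lemma mem_positive_support_pencil t i : nowhere_zero (pencil t) ->
  (i \in positive_support (pencil t)) =
  (i \in pencil_start) (+) (i \in below t).
Proof.
move=> nz; rewrite !finset.inE.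
have [->|il] := eqVneq i l.
  by rewrite /pencil al bl mulr0 addr0 ltr01.
rewrite /=.
have nr : pencil_root i != t by rewrite -pencil_eq0.
have -> : pencil t i = a i * (t - pencil_root i).
  rewrite /pencil /pencil_root mulrBr mulrCA divff ?a_neq0// mulr1 opprK.
  by rewrite addrC mulrC.
have [a0|a0|a0] := ltgtP (a i) 0; last by move: (a_neq0 il); rewrite a0 eqxx.
- by rewrite nmulr_rgt0// subr_lt0 ltNge le_eqVlt (negbTE nr).
- by rewrite pmulr_rgt0// subr_gt0.
Qed.

Lemma odd_card_positive_support_pencil t : nowhere_zero (pencil t) ->
  odd #|positive_support (pencil t)| = odd #|pencil_start| (+) odd #|below t|.
Proof.
move=> nz; set B := pencil_start; set L := below t.
have -> : positive_support (pencil t) = ((B :\: L) :|: (L :\: B))%SET.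
  apply/setP => i; rewrite mem_positive_support_pencil// finset.in_setU !finset.in_setD.
  by case: (i \in B); case: (i \in L).
rewrite cardsU (_ : _ :&: _ = finset.set0)%SET ?cards0 ?subn0; last first.
  apply/setP => i; rewrite finset.in_setI !finset.in_setD finset.in_set0.
  by case: (i \in B); case: (i \in L).
rewrite -(cardsID L B) -(cardsID B L) finset.setIC !oddD.
by case: (odd _); case: (odd _); case: (odd _).
Qed.
End Pencils.

Lemma card_ord_parity m c : #|[set k : 'I_m.*2 | odd k == c]%SET| = m.
Proof.
rewrite -sum1_card big_mkcond /=.
under eq_bigr do rewrite finset.inE.
elim: m => [|m IHm]; first by rewrite big_ord0.
rewrite doubleS !big_ord_recr /= IHm odd_double.
by case: c {IHm}; rewrite /= ?addn0 addn1.
Qed.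

Section OddSupports.
Context {R : realType} {T : finType}.
Variables (a b : T -> R) (l : T).
Hypotheses (al : a l = 0) (bl : b l = 1).
Hypothesis a_neq0 : forall i, i != l -> a i != 0.
Hypothesis root_inj : {in [set~ l]%SET &, injective (pencil_root a b)}.

(** The support at t is determined by the set of roots below t, hence by the
    number of these roots, which takes each value from 0 to 2 m - 1. The parity
    of the size of the support changes at every root, so half of these values
    give odd supports. *)
Lemma card_odd_positive_supports m : #|T| = m.*2 ->
  #|[set e : {set T} | odd #|e| & `[< exists2 t, nowhere_zero (pencil a b t) &
      e = positive_support (pencil a b t) >]]%SET| = m.
Proof.
move=> Tm.
pose D := [set~ l]%SET; pose below := sublevel D (pencil_root a b).
have D_card : #|D| = m.*2.-1 by rewrite cardsC1 Tm.
have ex_t (k : 'I_m.*2) : exists t,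
    nowhere_zero (pencil a b t) /\ #|below t| = k.
  have [|t [tD tk]] := @sublevel_card_exists _ _ D _ k root_inj.
    by rewrite D_card -ltnS prednK// (leq_ltn_trans _ (ltn_ord k)).
  by exists t; split=> //; apply/(nowhere_zero_pencilP al bl a_neq0).
have [tau tauP] := choice ex_t.
pose f k := positive_support (pencil a b (tau k)).
have f_inj : injective f.
  move=> j k fjk; apply/val_inj; rewrite /= -(tauP j).2 -(tauP k).2.
  congr #|pred_of_set _|; apply/setP => i; move/setP/(_ i): fjk.
  rewrite !(mem_positive_support_pencil al bl a_neq0); last 2 first.
  - exact: (tauP k).1.
  - exact: (tauP j).1.
  exact: addbI.
pose c := ~~ odd #|pencil_start a l|.
have f_odd k : odd #|f k| = (odd k == c).
  rewrite (odd_card_positive_support_pencil al bl a_neq0 (tauP k).1).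
  by rewrite -/below (tauP k).2 /c; do 2!case: (odd _).
rewrite -[RHS](card_ord_parity m c) -(card_imset _ f_inj).
congr #|pred_of_set _|.
apply/setP => e; rewrite finset.inE; apply/andP/imsetP => [[oe /asboolP[t nz et]]|].
  have lt_t : (#|below t| < m.*2)%N.
    apply: (@leq_ltn_trans #|D|).
      by apply/subset_leq_card/fintype.subsetP => i; rewrite finset.inE => /andP[].
    by rewrite D_card -Tm prednK//; apply/card_gt0P; exists l.
  pose k := Ordinal lt_t.
  have ek : e = f k.
    rewrite et; apply/setP => i.
    rewrite !(mem_positive_support_pencil al bl a_neq0)//; last exact: (tauP k).1.
    congr (_ (+) (i \in pred_of_set _)).
    by apply: sublevel_eq_card; rewrite -/D -/below (tauP k).2.
  by exists k => //; rewrite finset.inE -f_odd -ek.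
move=> [k]; rewrite finset.inE -f_odd => ok ->; split=> //.
by apply/asboolP; exists (tau k) => //; exact: (tauP k).1.
Qed.
End OddSupports.

(** * Counting the crossing pairs *)

Lemma crossing_sym (R : realType) (n : nat) (p : 'I_n -> 'rV[R]_3)
    (e f : {set 'I_n}) : crossing p e f -> crossing p f e.
Proof. by rewrite /crossing disjoint_sym classical_sets.setIC. Qed.

(** Disjoint triples among six vertices are complementary, so a crossing pair is
    recorded by its member that contains a chosen vertex l. *)
Lemma card_crossing_pairs (R : realType) (p : 'I_6 -> 'rV[R]_3) (l : 'I_6) :
  #|crossing_pairs p 3| =
  #|[set e : {set 'I_6} |
      [&& #|e| == 3%N, l \in e & `[< crossing p e (~: e) >]]]%SET|.
Proof.
set A := [set e | _]%SET.
have disj3 (e f : {set 'I_6}) : #|e| = 3%N -> #|f| = 3%N -> [disjoint e & f]%B ->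
    f = (~: e)%SET.
  move=> e3 f3; rewrite disjoint_sym finset.disjoints_subset => fe.
  by apply/eqP; rewrite eqEcard fe f3 cardsCs finset.setCK card_ord e3.
have A_inj : {in A &, injective (fun e => [set e; ~: e]%SET)}.
  move=> e f; rewrite !finset.inE => /and3P[_ le _] /and3P[_ lf _] /setP/(_ e).
  rewrite !finset.inE eqxx /= => /esym/orP[/eqP//|/eqP ef].
  by move: le; rewrite ef finset.inE lf.
rewrite -(card_in_imset A_inj); congr #|pred_of_set _|; apply/setP => P.
rewrite finset.inE; apply/asboolP/imsetP => [[e [f []]]|[e]]; last first.
  rewrite !finset.inE => /and3P[/eqP e3 _ /asboolP ec] ->.
  by exists e, (~: e)%SET; rewrite !finset.inE e3 cardsCs finset.setCK card_ord e3.
rewrite !finset.inE => /eqP e3 /eqP f3 -> ef.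
have fE := disj3 _ _ e3 f3 ef.1.
have [le|le] := boolP (l \in e).
  by exists e; rewrite ?fE// !finset.inE e3 le -fE; apply/asboolP.
have eE : e = (~: f)%SET by rewrite fE finset.setCK.
exists f; last by rewrite -eE finset.setUC.
rewrite !finset.inE f3 -eE; apply/and3P; split=> //.
  by rewrite fE finset.inE.
by apply/asboolP/crossing_sym.
Qed.
Lemma affine_dependency_pencil (R : realType) (n : nat) (p : 'I_n -> 'rV[R]_3)
    (a b : 'I_n -> R) t :
  affine_dependency p a -> affine_dependency p b ->
  affine_dependency p (pencil a b t).
Proof.
move=> da db; have := affine_dependency_lin 1 t db da.
by congr affine_dependency; apply/funext => i; rewrite /pencil mul1r.
Qed.

(** A dependency with a positive coefficient at l belongs, after division by
    that coefficient, to the line b + t a: the difference with the right member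
    of the line vanishes at both l and m, hence everywhere. *)
Lemma crossing_positive_support (R : realType) (p : 'I_6 -> 'rV[R]_3)
    (a b : 'I_6 -> R) (l m : 'I_6) (e : {set 'I_6}) :
  general_position p -> l != m ->
  affine_dependency p a -> a l = 0 -> a m = 1 ->
  affine_dependency p b -> b l = 1 -> b m = 0 -> #|e| = 3%N ->
  (l \in e /\ crossing p e (~: e)) <->
  exists2 t, nowhere_zero (pencil a b t) & e = positive_support (pencil a b t).
Proof.
move=> gp lm da al am db bl bm e3.
split=> [[le /(crossing_setCP gp e3)[c [dc ce cn]]]|[t nz et]]; last first.
  split; first by rewrite et finset.inE /pencil al bl mulr0 addr0 ltr01.
  apply/(crossing_setCP gp e3); exists (pencil a b t); split=> [|i|i].
  - exact: affine_dependency_pencil.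
  - by rewrite et finset.inE.
  - by rewrite et finset.inE -leNgt lt_neqAle nz.
have cl : 0 < c l by exact: ce.
pose t := c m / c l.
have cE i : c i = c l * pencil a b t i.
  apply/eqP; rewrite -subr_eq0; apply/eqP.
  have dd := affine_dependency_lin 1 (- c l) dc (affine_dependency_lin 1 t db da).
  have := affine_dependency_two_zeros gp dd lm.
  rewrite al am bl bm /t => /(_ _ _ i) <-.
  - by rewrite /pencil !mul1r mulNr.
  - by rewrite !mul1r mulr0 addr0 mulr1 subrr.
  - by rewrite !mul1r mulr1 add0r mulNr mulrC divfK ?subrr// gt_eqF.
exists t.
  move=> i; have : c i != 0.
    by have [/ce/gt_eqF ->|/cn/lt_eqF ->] := boolP (i \in e).
  by rewrite cE mulf_eq0 negb_or => /andP[].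
apply/setP => i; rewrite finset.inE -(pmulr_rgt0 _ cl) -cE.
by have [/ce|/cn ci] := boolP (i \in e) => //; rewrite ltNge ltW.
Qed.

Theorem theorem3 (R : realType) (p : 'I_6 -> 'rV[R]_3)
    (hconv : convex_position p) (hgen : general_position p) :
  #|crossing_pairs p 3| = 3%N.
Proof.
pose l : 'I_6 := ord0; pose m : 'I_6 := ord_max.
have lm : l != m by [].
have [a [da al am]] := affine_dependency_exists hgen lm.
have [b [db bm bl]] := affine_dependency_exists hgen (isT : m != l).
have a_neq0 i : i != l -> a i != 0.
  move=> il; apply/eqP => ai; move/eqP: am.
  by rewrite (affine_dependency_two_zeros hgen da il ai al) eq_sym oner_eq0.
have d_pencil t := affine_dependency_pencil t da db.
have pencil_l t : pencil a b t l = 1 by rewrite /pencil al bl mulr0 addr0.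
have root_inj : {in [set~ l]%SET &, injective (pencil_root a b)}.
  move=> i j; rewrite !finset.inE => il jl rij; apply/eqP/negPn/negP => ij.
  pose t := pencil_root a b i.
  have pi0 : pencil a b t i = 0 by apply/eqP; rewrite (pencil_eq0 b a_neq0).
  have pj0 : pencil a b t j = 0 by apply/eqP; rewrite (pencil_eq0 b a_neq0)// -rij.
  have := affine_dependency_two_zeros hgen (d_pencil t) ij pi0 pj0 l.
  by rewrite pencil_l => /eqP; rewrite oner_eq0.
(* Both the support and its complement, the support of the opposite dependency,
   have at least two elements, and 3 is the only odd number from 2 to 4. *)
have card3 t : nowhere_zero (pencil a b t) ->
    odd #|positive_support (pencil a b t)| =
    (#|positive_support (pencil a b t)| == 3%N).
  move=> nz.
  have ge2 := affine_dependency_pos2 hgen hconv (d_pencil t) (nz l).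
  have dN : affine_dependency p (fun i => - pencil a b t i).
    have := affine_dependency_lin (-1) 0 (d_pencil t) da.
    by congr affine_dependency; apply/funext => i; rewrite mulN1r mul0r addr0.
  have := affine_dependency_pos2 hgen hconv dN (k := l).
  rewrite oppr_eq0 => /(_ (nz l)).
  have -> : positive_support (fun i => - pencil a b t i) =
      (~: positive_support (pencil a b t))%SET.
    by apply/setP => i; rewrite !finset.inE oppr_gt0 -leNgt lt_neqAle nz.
  rewrite cardsCs finset.setCK card_ord.
  by move: ge2; case: #|_| => [|[|[|[|[|[|]]]]]].
rewrite (card_crossing_pairs p l).
have T6 : #|{: 'I_6}| = 3.*2 by rewrite card_ord.
rewrite -[RHS](card_odd_positive_supports al bl a_neq0 root_inj T6).
congr #|pred_of_set _|; apply/setP => e; rewrite !finset.inE.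
have cs := crossing_positive_support hgen lm da al am db bl bm (e := e).
apply/and3P/andP => [[/eqP e3 le /asboolP ec]|[oe /asboolP[t nz et]]].
  by rewrite e3; split=> //; apply/asboolP/(cs e3).
have e3 : #|e| = 3%N by apply/eqP; rewrite et -card3// -et.
have [le ec] : l \in e /\ crossing p e (~: e) by apply/(cs e3); exists t.
by split=> //; [rewrite e3|apply/asboolP].
Qed.
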